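(* Let $(\mathcal{M},\tau)$ be a non-commutative probability space and let $X\in\mathcal{M}$ be a self-adjoint random variable with a symmetric law. Then $$\Psi(X)\ge\frac{1}{\tau(X^2)}.$$
   Context: A non-commutative probability space $(\mathcal{M},\tau)$ is a von Neumann algebra $\mathcal{M}$ with a nondegenerate normal state $\tau$, not necessarily faithful. For self-adjoint $A\in\mathcal{M}$, the law of $A$ is the unique probability measure $\mu$ on $\mathbb{R}$ with $\tau(A^k)=\int x^k\,d\mu(x)$ for all $k\in\mathbb{N}$. For $X$ with symmetric law $\mu$, the Boolean Fisher information is $\Psi(X)=\iint\frac{\log x^2-\log y^2}{x^2-y^2}\,d\mu(x)\,d\mu(y)\in(0,+\infty]$, the integrand being understood with its continuous extension on the diagonal $x^2=y^2$ (value $1/x^2$, and $+\infty$ if $x=0$ or $y=0$). Convention: $1/0=+\infty$. *)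

(* Defs.v *)
From HB Require Import structures.
From mathcomp Require Import all_boot all_order all_algebra.
From mathcomp Require Import sesquilinear complex.
From mathcomp Require Import all_classical all_reals all_analysis.

Set Implicit Arguments.
Unset Strict Implicit.
Unset Printing Implicit Defensive.

Import Order.TTheory GRing.Theory Num.Theory.
Import numFieldNormedType.Exports.

Local Open Scope classical_set_scope.
Local Open Scope complex_scope.
Local Open Scope ring_scope.

(* The scalar product is linear in its first argument and conjugate-linear in
   its second; the norm of [H] takes its values in [R[i]]. *)
Record hilbertSpace (R : realType) := HilbertSpace {
  hilbert_sort :> completeNormedModType R[i];
  inner : {dot hilbert_sort for (@Num.conj R[i])};
  inner_norm : forall v : hilbert_sort, inner v v = `|v| ^+ 2
}.

Section Operators.
Context {R : realType} {H : hilbertSpace R}.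
Implicit Types (A B T : H -> H) (M S : set (H -> H)).

Definition bounded_operator T : Prop := linear T /\ continuous T.

Definition adjoint A B : Prop :=
  forall v w : H, inner H (A v) w = inner H v (B w).

Definition self_adjoint A : Prop := adjoint A A.

Definition commutant S : set (H -> H) :=
  [set T | bounded_operator T /\ forall A, S A -> T \o A = A \o T].

(* The bicommutant condition makes [M] a unital algebra of bounded operators. *)
Definition von_neumann_algebra M : Prop :=
  (forall A, M A -> exists2 B, M B & adjoint A B) /\
  commutant (commutant M) = M.

Definition positive_operator A : Prop := forall v : H, 0 <= inner H (A v) v.

Definition loewner A B : Prop :=
  positive_operator (fun v => B v - A v).

(* States are total functions on [H -> H], constrained only on [M]. *)
Definition state_on M (tau : (H -> H) -> R[i]) : Prop :=
  [/\ forall (a : R[i]) A B, M A -> M B ->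
        tau (fun v => a *: A v + B v) = a * tau A + tau B,
      forall A, M A -> positive_operator A -> 0 <= tau A
    & tau idfun = 1].

Definition self_adjoint_part M : set (H -> H) := [set A | M A /\ self_adjoint A].

Definition upward_directed (D : set (H -> H)) : Prop :=
  D !=set0 /\
  forall A B, D A -> D B -> exists C, [/\ D C, loewner A C & loewner B C].

Definition operator_supremum M (D : set (H -> H)) T : Prop :=
  [/\ self_adjoint_part M T,
      forall A, D A -> loewner A T
    & forall B, self_adjoint_part M B ->
        (forall A, D A -> loewner A B) -> loewner T B].

(* [tau] preserves suprema of increasing nets of self-adjoint elements. *)
Definition normal_on M (tau : (H -> H) -> R[i]) : Prop :=
  forall D T, D `<=` self_adjoint_part M -> upward_directed D ->
    operator_supremum M D T -> supremums (tau @` D) (tau T).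

(* The GNS representation of [tau] is faithful. This is weaker than
   faithfulness of [tau]. *)
Definition nondegenerate_on M (tau : (H -> H) -> R[i]) : Prop :=
  forall X, M X -> (forall A B, M A -> M B -> tau (A \o X \o B) = 0) ->
    X = (fun=> 0).

End Operators.

Record ncProbabilitySpace (R : realType) := NCProbabilitySpace {
  ncp_hilbert : hilbertSpace R;
  ncp_algebra : set (ncp_hilbert -> ncp_hilbert);
  ncp_state : (ncp_hilbert -> ncp_hilbert) -> R[i];
  ncp_von_neumann : von_neumann_algebra ncp_algebra;
  ncp_state_on : state_on ncp_algebra ncp_state;
  ncp_normal : normal_on ncp_algebra ncp_state;
  ncp_nondegenerate : nondegenerate_on ncp_algebra ncp_state
}.

Arguments ncp_algebra {R} P _ : rename.
Arguments ncp_state {R} P _ : rename.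

Section Law.
Context {R : realType}.
Implicit Type mu : probability (measurableTypeR R) R.

Definition moment (P : ncProbabilitySpace R)
    (X : ncp_hilbert P -> ncp_hilbert P) (k : nat) : R[i] :=
  ncp_state P (iter k X).

(* [mu] is the law of [X] for self-adjoint [X] in the algebra; since [X] is
   bounded, the moments determine [mu]. *)
Definition is_law (P : ncProbabilitySpace R)
    (X : ncp_hilbert P -> ncp_hilbert P) mu : Prop :=
  forall k : nat, mu.-integrable setT (fun x : R => (x ^+ k)%:E) /\
    moment X k = (\int[mu]_x (x ^+ k))%:C.

Definition symmetric_law mu : Prop :=
  forall A : set R, measurable A -> mu (-%R @^-1` A) = mu A.

Definition fisher_kernel (x y : R) : \bar R :=
  if (x == 0) || (y == 0) then +oo%E
  else if x ^+ 2 == y ^+ 2 then ((x ^+ 2)^-1)%:E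
  else ((ln (x ^+ 2) - ln (y ^+ 2)) / (x ^+ 2 - y ^+ 2))%:E.

Definition boolean_fisher mu : \bar R :=
  (\int[mu \x mu]_z fisher_kernel z.1 z.2)%E.

End Law.

(* Main.v *)
(** The function s |-> ln s - 2 s / c + s^2 / (2 c^2) is nondecreasing on
    (0, +oo), because its derivative is (1 - s / c)^2 / s.  Hence the kernel
    is bounded below by the affine minorant l(x) + l(y), where
    l(x) = 1/c - x^2 / (2 c^2).  Integrating gives
    Psi(X) >= 2/c - tau(X^2) / c^2 for every c > 0.  The choice c = tau(X^2)
    gives the bound when tau(X^2) > 0; letting c tend to 0 gives
    Psi(X) = +oo when tau(X^2) = 0. *)

Require Import Defs.
From HB Require Import structures.
From mathcomp Require Import all_boot all_order all_algebra.
From mathcomp Require Import sesquilinear complex.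
From mathcomp Require Import all_classical all_reals all_analysis.
From mathcomp Require Import measurable_realfun ring lra.

Import Order.TTheory GRing.Theory Num.Theory.
Import HBNNSimple.

Local Open Scope ring_scope.

(* The integral of a nonmeasurable function is still a difference of suprema
   of integrals of simple functions, hence monotone. *)
Lemma le_integral_nonmeasurable {d : measure_display} {T : measurableType d}
    {R : realType} (mu : {measure set T -> \bar R}) (f g : T -> \bar R) :
  (forall x, f x <= g x)%E -> (\int[mu]_x f x <= \int[mu]_x g x)%E.
Proof.
move=> fg; rewrite /integral !patch_setT.
have le_sup (u v : T -> \bar R) : (forall x, u x <= v x)%E ->
    (ereal_sup [set sintegral mu h |
       h in [set h : {nnsfun T >-> R} | forall x, (h x)%:E <= u x]] <=
     ereal_sup [set sintegral mu h |
       h in [set h : {nnsfun T >-> R} | forall x, (h x)%:E <= v x]])%E%classic.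
  move=> uv; apply: ereal_sup_le => _ [h hu <-].
  by exists h => // x; apply: le_trans (uv x).
(* Passing from [f] to [g] raises the positive part and lowers the negative part. *)
apply: leeB; apply: le_sup => x; rewrite !(funeposE, funenegE) ge_max le_max.
- by rewrite fg /= le_max lexx orbT.
- by rewrite leeN2 fg /= le_max lexx orbT.
Qed.

Lemma integral_probability_cst (d : measure_display) (T : measurableType d)
    (R : realType) (P : probability T R) (r : \bar R) : (\int[P]_x r = r)%E.
Proof.
by rewrite -[RHS]mule1 -(probability_setT P) -(integral_cst P measurableT r).
Qed.

Section ProbabilityProduct.
Context {d1 d2 : measure_display} {T1 : measurableType d1}
  {T2 : measurableType d2} {R : realType}.
Variables (P : probability T1 R) (Q : probability T2 R).

(** By Tonelli, the inner integral over the second coordinate only contributes the total mass 1 of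
    [Q]. *)
Lemma integrable_prod_fst (f : T1 -> \bar R) : P.-integrable setT f ->
  (P \x Q)%E.-integrable setT (fun z => f z.1).
Proof.
move=> /integrableP[mf foo]; apply/integrable12ltyP.
  exact: measurableT_comp.
under eq_integral do rewrite /= integral_probability_cst.
exact: foo.
Qed.

Lemma integral_prod_fst (f : T1 -> \bar R) : P.-integrable setT f ->
  (\int[P \x Q]_z f z.1 = \int[P]_x f x)%E.
Proof.
move=> /integrable_prod_fst/integral12_prod_meas1 <-; apply: eq_integral => x _.
by rewrite /fubini_F /= integral_probability_cst.
Qed.

Lemma integrable_prod_snd (f : T2 -> \bar R) : Q.-integrable setT f ->
  (P \x Q)%E.-integrable setT (fun z => f z.2).
Proof.
move=> /integrableP[mf foo]; apply/integrable21ltyP.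
  exact: measurableT_comp.
under eq_integral do rewrite /= integral_probability_cst.
exact: foo.
Qed.

Lemma integral_prod_snd (f : T2 -> \bar R) : Q.-integrable setT f ->
  (\int[P \x Q]_z f z.2 = \int[Q]_x f x)%E.
Proof.
move=> /integrable_prod_snd/integral21_prod_meas1 <-; apply: eq_integral => x _.
by rewrite /fubini_G /= integral_probability_cst.
Qed.

End ProbabilityProduct.

Section FisherKernelBound.
Context {R : realType}.
Variable c : R.
Hypothesis c_gt0 : 0 < c.

Lemma ler_ln_sub_quadratic (a b : R) : 0 < b -> b <= a ->
  (2 / c) * (a - b) - (a ^+ 2 - b ^+ 2) / (2 * c ^+ 2) <= ln a - ln b.
Proof.
move=> b_gt0 ba.
pose f (s : R) := ln s - (2 / c) * s + (2 * c ^+ 2)^-1 * s ^+ 2.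
have df (s : R) : 0 < s -> is_derive s (1 : R) f ((1 - s / c) ^+ 2 / s).
  move=> s_gt0; have lns := is_derive1_ln s_gt0.
  apply: is_derive_eq; rewrite /GRing.scale /=.
  by field; rewrite !gt_eqF.
have : f b <= f a.
  apply: (@ger0_derive1_ndecr _ f b a) => //.
  - move=> s; rewrite in_itv /= => /andP[bs _].
    by have [] := df s (lt_trans b_gt0 bs).
  - move=> s; rewrite in_itv /= => /andP[bs _].
    have s_gt0 := lt_trans b_gt0 bs.
    rewrite derive1E (@derive_val _ _ _ _ _ _ _ (df s s_gt0)).
    by rewrite divr_ge0 ?sqr_ge0 ?ltW.
  - apply: derivable_within_continuous => s; rewrite in_itv /= => /andP[bs _].
    by have [] := df s (lt_le_trans b_gt0 bs).
rewrite /f mulrC => fab; lra.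
Qed.

(** In the variables [x ^+ 2] and [y ^+ 2], the sum [kernel_minorant x + kernel_minorant y] is the
    tangent plane of the kernel at the diagonal point [(c, c)]. *)
Definition kernel_minorant (x : R) : R := c^-1 - (2 * c ^+ 2)^-1 * x ^+ 2.

Lemma kernel_minorant_le (x y : R) :
  ((kernel_minorant x + kernel_minorant y)%:E <= fisher_kernel x y)%E.
Proof.
rewrite /fisher_kernel; case: ifPn => [_|]; first exact: leey.
rewrite negb_or => /andP[x0 y0]; rewrite /kernel_minorant.
have {x0}: 0 < x ^+ 2 by rewrite exprn_even_gt0.
have {y0}: 0 < y ^+ 2 by rewrite exprn_even_gt0.
move: (x ^+ 2) (y ^+ 2) => a b b_gt0 a_gt0.
have c0 : c != 0 by rewrite gt_eqF.
case: ifPn => [/eqP <-|ab]; rewrite lee_fin.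
  rewrite -subr_ge0.
  have -> : a^-1 - (c^-1 - (2 * c ^+ 2)^-1 * a + (c^-1 - (2 * c ^+ 2)^-1 * a))
      = (1 - a / c) ^+ 2 / a.
    by field; rewrite c0 gt_eqF.
  by rewrite divr_ge0 ?sqr_ge0 ?ltW.
(* Both sides are symmetric: swapping [a] and [b] negates numerator and denominator of the
   quotient. *)
wlog ba : a b a_gt0 b_gt0 ab / b < a => [hw|].
  case: (ltgtP b a) => [ba|ba|/esym/eqP]; last by rewrite (negPf ab).
    exact: hw.
  rewrite addrC -[X in _ <= X]mulrNN -invrN !opprB.
  by apply: hw => //; rewrite eq_sym.
(* Multiplied by [a - b], the minorant [2 / c - (a + b) / (2 * c ^+ 2)] becomes the left side of
   [ler_ln_sub_quadratic]. *)
rewrite ler_pdivlMr ?subr_gt0//.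
apply: le_trans (ler_ln_sub_quadratic a b b_gt0 (ltW ba)).
by rewrite le_eqVlt; apply/predU1P; left; field.
Qed.

Lemma boolean_fisher_ge (mu : probability (measurableTypeR R) R) :
  mu.-integrable setT (fun x : R => (x ^+ 2)%:E) ->
  ((2 / c - (\int[mu]_x (x ^+ 2)) / c ^+ 2)%:E <= boolean_fisher mu)%E.
Proof.
move=> sq_int.
pose l (x : R) : \bar R := (kernel_minorant x)%:E.
have cst_int : mu.-integrable setT (fun=> (c^-1)%:E).
  by apply: finite_measure_integrable_cst.
have zsq_int := integrableZl measurableT (2 * c ^+ 2)^-1 sq_int.
have l_int : mu.-integrable setT l := integrableB measurableT cst_int zsq_int.
have int_l : (\int[mu]_x l x =
    (c^-1 - (2 * c ^+ 2)^-1 * \int[mu]_x (x ^+ 2))%:E)%E.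
  rewrite (integralB measurableT cst_int zsq_int) integral_probability_cst.
  rewrite integralZl// /Rintegral.
  by rewrite EFinB EFinM fineK//; exact: integrable_fin_num.
(* Pointwise domination suffices here, so [fisher_kernel] enters without a measurability proof. *)
apply: le_trans (le_integral_nonmeasurable (mu \x mu)%E _ _
  (fun z => kernel_minorant_le z.1 z.2)).
have l1_int : (mu \x mu)%E.-integrable setT (fun z => l z.1).
  exact: integrable_prod_fst.
have l2_int : (mu \x mu)%E.-integrable setT (fun z => l z.2).
  exact: integrable_prod_snd.
rewrite (integralD measurableT l1_int l2_int).
rewrite integral_prod_fst// integral_prod_snd// int_l -EFinD lee_fin.
by rewrite le_eqVlt; apply/predU1P; left; field; rewrite gt_eqF.
Qed.

End FisherKernelBound.

(* The inverse on the extended reals satisfies [0^-1 = +oo]. *)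
Theorem corollary1p9 (R : realType) (P : ncProbabilitySpace R)
    (X : ncp_hilbert P -> ncp_hilbert P)
    (mu : probability (measurableTypeR R) R)
    (X_in : ncp_algebra P X) (X_sa : self_adjoint X)
    (X_law : is_law X mu) (mu_sym : symmetric_law mu) :
  ((complex.Re (moment X 2))%:E^-1 <= boolean_fisher mu)%E.
Proof.
have [sq_int ->] := X_law 2%N.
have := fun c c_gt0 => @boolean_fisher_ge R c c_gt0 mu sq_int.
rewrite [complex.Re _]/=.
have : 0 <= (\int[mu]_x (x ^+ 2))%R.
  by apply: Rintegral_ge0 => x _; exact: sqr_ge0.
move: (\int[mu]_x (x ^+ 2))%R => m; rewrite le_eqVlt => /predU1P[<-|m_gt0] lower.
  rewrite inve0 leye_eq; apply/eqP/eq_infty => r.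
  (* With second moment 0 the lower bound is [2 / c], which this choice makes equal to [|r| + 1],
     hence above the arbitrary real [r]; the summand 1 keeps the denominator positive at [r = 0]. *)
  pose c : R := 2 / (`|r| + 1).
  have r1_gt0 : 0 < `|r| + 1 by rewrite ltr_wpDl.
  apply: le_trans (lower c _); last by rewrite divr_gt0.
  rewrite lee_fin mul0r subr0 /c invf_div mulrCA divff ?mulr1 ?pnatr_eq0//.
  by apply: (le_trans (ler_norm r)); rewrite lerDl.
(* The value [c = m] maximises [2 / c - m / c ^+ 2] over positive [c], and the maximum is [m^-1]. *)
rewrite inver gt_eqF//; apply: le_trans (lower m m_gt0).
by rewrite lee_fin; rewrite le_eqVlt; apply/predU1P; left; field; rewrite gt_eqF.
Qed.
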